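(* Let $\mathsf{MC}$ be the category of strict monoidal categories and strict monoidal functors, and let $\mathsf{PreNet}$ be the category of pre-nets. Let $U_{\mathsf{MON}}\colon\mathsf{MC}\to\mathsf{PreNet}$ be the functor which sends a strict monoidal category $C$ to the pre-net $\overline{\mathrm{Mor}\,C}\rightrightarrows(\mathrm{Ob}\,C)^*$ and a strict monoidal functor to the induced morphism of pre-nets (as described in the context). Then $U_{\mathsf{MON}}$ has a left adjoint $F_{\mathsf{MON}}\colon\mathsf{PreNet}\to\mathsf{MC}$ which sends a pre-net $s,t\colon T\to S^*$ to the strict monoidal category where - the objects are given by the free monoid on $S$, and - the morphisms are defined inductively as the closure of the transitions $\tau\colon s(\tau)\to t(\tau)$, $\tau\in T$, and the identities under composition $\circ$ and monoidal product $\otimes$, quotiented by the axioms of a category and of a strict monoidal category, including $(f\otimes g)\otimes h=f\otimes(g\otimes h)$, $1\otimes f=f\otimes 1=f$ (where $1$ is the identity of the monoidal unit), and $(f_1\circ g_1)\otimes(f_2\circ g_2)=(f_1\otimes f_2)\circ(g_1\otimes g_2)$ whenever all composites are defined. On a morphism of pre-nets $(f,g)$, the functor $F_{\mathsf{MON}}(f,g)$ has object component the monoid homomorphism between free monoids induced by $g$, and morphism component the unique composition-preserving monoid homomorphism extending $f$.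
   Context: $X^*$ denotes the underlying set of the free monoid on a set $X$ (finite words in $X$), and $(-)^*\colon\mathsf{Set}\to\mathsf{Set}$ the corresponding monad. A pre-net is a pair of functions $s,t\colon T\to S^*$, with $T$ and $S$ sets. A morphism of pre-nets from $(s,t\colon T\to S^* )$ to $(s',t'\colon T'\to S'^* )$ is a pair of functions $(f\colon T\to T',\,g\colon S\to S')$ with $s'\circ f=g^*\circ s$ and $t'\circ f=g^*\circ t$. These form the category $\mathsf{PreNet}$. For a strict monoidal category $C$, let $\epsilon\colon(\mathrm{Ob}\,C)^*\to\mathrm{Ob}\,C$ send a word $x_1\cdots x_n$ to $x_1\otimes\cdots\otimes x_n$ (the empty word to the monoidal unit). Then $$\overline{\mathrm{Mor}\,C}=\{(e,x,y)\in\mathrm{Mor}\,C\times(\mathrm{Ob}\,C)^*\times(\mathrm{Ob}\,C)^*\mid \text{the source of } e \text{ is } \epsilon(x) \text{ and the target of } e \text{ is } \epsilon(y)\},$$ and the pre-net $U_{\mathsf{MON}}(C)$ has places $\mathrm{Ob}\,C$, transitions $\overline{\mathrm{Mor}\,C}$, source map $(e,x,y)\mapsto x$ and target map $(e,x,y)\mapsto y$. A strict monoidal functor $F\colon C\to D$ is sent to the pair whose transition component is $(e,x,y)\mapsto(F(e),(\mathrm{Ob}\,F)^*(x),(\mathrm{Ob}\,F)^*(y))$ and whose place component is $\mathrm{Ob}\,F$. *)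

(* Defs.v *)
From HB Require Import structures.
From mathcomp Require Import all_boot.
From mathcomp Require Import boolp.

Set Implicit Arguments.
Unset Strict Implicit.
Unset Printing Implicit Defensive.

Local Open Scope quotient_scope.

Record category := Category {
  obj :> Type;
  hom : obj -> obj -> Type;
  cid : forall a, hom a a;
  ccomp : forall a b c, hom b c -> hom a b -> hom a c;
  ccompA : forall a b c d (h : hom c d) (g : hom b c) (f : hom a b),
    ccomp h (ccomp g f) = ccomp (ccomp h g) f;
  ccomp1f : forall a b (f : hom a b), ccomp (cid b) f = f;
  ccompf1 : forall a b (f : hom a b), ccomp f (cid a) = f }.

Arguments hom {_} _ _.
Arguments cid {_} a.
Arguments ccomp {_ a b c} _ _.

Record functor (C D : category) := Functor {
  fobj :> C -> D;
  fmap : forall a b : C, hom a b -> hom (fobj a) (fobj b);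
  fmap_id : forall a : C, fmap (cid a) = cid (fobj a);
  fmap_comp : forall (a b c : C) (g : hom b c) (f : hom a b),
    fmap (ccomp g f) = ccomp (fmap g) (fmap f) }.

Arguments Functor {C D} fobj fmap _ _.
Arguments fmap {C D} _ {a b} _.

(* An adjunction L -| R, as a bijection Hom(L c, d) ~ Hom(c, R d) natural
   in c and d. *)
Record adjunction (C D : category) (L : functor C D) (R : functor D C) :=
  Adjunction {
  transpose : forall (c : C) (d : D), hom (L c) d -> hom c (R d);
  untranspose : forall (c : C) (d : D), hom c (R d) -> hom (L c) d;
  transposeK : forall c d, cancel (@transpose c d) (@untranspose c d);
  untransposeK : forall c d, cancel (@untranspose c d) (@transpose c d);
  transpose_natural : forall (c c' : C) (d d' : D)
      (u : hom c' c) (v : hom d d') (k : hom (L c) d),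
    transpose (ccomp v (ccomp k (fmap L u)))
      = ccomp (fmap R v) (ccomp (transpose k) u) }.

Record prenet := Prenet {
  trans : Type;
  place : Type;
  pre : trans -> seq place;
  post : trans -> seq place }.

Record prenet_hom (P Q : prenet) := PrenetHom {
  on_trans : trans P -> trans Q;
  on_place : place P -> place Q;
  on_pre : forall t, pre (on_trans t) = map on_place (pre t);
  on_post : forall t, post (on_trans t) = map on_place (post t) }.

Lemma prenet_hom_eq P Q (u v : prenet_hom P Q) :
  on_trans u =1 on_trans v -> on_place u =1 on_place v -> u = v.
Proof.
case: u v => [f g p q] [f' g' p' q'] /= /funext ef /funext eg.
by subst f' g'; congr PrenetHom; apply: Prop_irrelevance.
Qed.

Definition prenet_id P : prenet_hom P P.
Proof. by exists id id => t; rewrite map_id. Defined.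

Definition prenet_comp P Q R (v : prenet_hom Q R) (u : prenet_hom P Q) :
  prenet_hom P R.
Proof.
exists (on_trans v \o on_trans u) (on_place v \o on_place u) => t /=.
- by rewrite !on_pre map_comp.
- by rewrite !on_post map_comp.
Defined.

Definition PreNet : category.
Proof.
apply: (@Category prenet prenet_hom prenet_id prenet_comp) => *;
  exact: prenet_hom_eq.
Defined.

(* Small categories are given by a set of objects and a set of all morphisms,
   so that the strict monoidal axioms are plain equations in these two sets.
   [comp g f] is g o f; by proof irrelevance it does not depend on the proof
   that g and f are composable. *)
Record smcat := SMCat {
  ob : Type;
  mor : Type;
  src : mor -> ob;
  tgt : mor -> ob;
  idm : ob -> mor;
  comp : forall g f : mor, src g = tgt f -> mor;
  src_id : forall x, src (idm x) = x;
  tgt_id : forall x, tgt (idm x) = x;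
  src_comp : forall g f (p : src g = tgt f), src (comp p) = src f;
  tgt_comp : forall g f (p : src g = tgt f), tgt (comp p) = tgt g;
  comp1m : forall x f (p : src (idm x) = tgt f), comp p = f;
  compm1 : forall x f (p : src f = tgt (idm x)), comp p = f;
  compmA : forall h g f (p : src g = tgt f) (q : src h = tgt g)
      (p' : src h = tgt (comp p)) (q' : src (comp q) = tgt f),
    comp p' = comp q';
  one : ob;
  tens_ob : ob -> ob -> ob;
  tens : mor -> mor -> mor;
  tens_obA : associative tens_ob;
  tens_ob1x : left_id one tens_ob;
  tens_obx1 : right_id one tens_ob;
  tensA : associative tens;
  tens1m : left_id (idm one) tens;
  tensm1 : right_id (idm one) tens;
  src_tens : forall f g, src (tens f g) = tens_ob (src f) (src g);
  tgt_tens : forall f g, tgt (tens f g) = tens_ob (tgt f) (tgt g);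
  tens_id : forall x y, tens (idm x) (idm y) = idm (tens_ob x y);
  tens_comp : forall f1 g1 f2 g2
      (p1 : src f1 = tgt g1) (p2 : src f2 = tgt g2)
      (p : src (tens f1 f2) = tgt (tens g1 g2)),
    tens (comp p1) (comp p2) = comp p }.

Arguments idm {_} _.
Arguments comp {_} g f _.
Arguments one {_}.

Record smfunctor (C D : smcat) := SMFunctor {
  on_ob : ob C -> ob D;
  on_mor : mor C -> mor D;
  on_src : forall f, src (on_mor f) = on_ob (src f);
  on_tgt : forall f, tgt (on_mor f) = on_ob (tgt f);
  on_id : forall x, on_mor (idm x) = idm (on_ob x);
  on_comp : forall g f (p : src g = tgt f)
      (p' : src (on_mor g) = tgt (on_mor f)),
    on_mor (comp g f p) = comp (on_mor g) (on_mor f) p';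
  on_one : on_ob one = one;
  on_tens_ob : forall x y, on_ob (tens_ob x y) = tens_ob (on_ob x) (on_ob y);
  on_tens : forall f g, on_mor (tens f g) = tens (on_mor f) (on_mor g) }.

Lemma smfunctor_eq C D (F G : smfunctor C D) :
  on_ob F =1 on_ob G -> on_mor F =1 on_mor G -> F = G.
Proof.
case: F G => [o m a1 a2 a3 a4 a5 a6 a7] [o' m' b1 b2 b3 b4 b5 b6 b7] /=.
move=> /funext eo /funext em; subst o' m'.
by congr SMFunctor; apply: Prop_irrelevance.
Qed.

Definition smfunctor_id C : smfunctor C C.
Proof.
by exists id id => // g f p p'; congr comp; apply: Prop_irrelevance.
Defined.

Definition smfunctor_comp C D E (G : smfunctor D E) (F : smfunctor C D) :
  smfunctor C E.
Proof.
exists (on_ob G \o on_ob F) (on_mor G \o on_mor F) => /=.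
- by move=> f; rewrite !on_src.
- by move=> f; rewrite !on_tgt.
- by move=> x; rewrite !on_id.
- move=> g f p p'.
  have q : src (on_mor F g) = tgt (on_mor F f) by rewrite on_src on_tgt p.
  by rewrite (on_comp p q) (on_comp q p').
- by rewrite !on_one.
- by move=> x y; rewrite !on_tens_ob.
- by move=> f g; rewrite !on_tens.
Defined.

Definition MC : category.
Proof.
apply: (@Category smcat smfunctor smfunctor_id smfunctor_comp) => *;
  exact: smfunctor_eq.
Defined.

Definition eps (C : smcat) : seq (ob C) -> ob C := foldr (@tens_ob C) one.

Lemma eps_map C D (F : smfunctor C D) w :
  eps (map (on_ob F) w) = on_ob F (eps w).
Proof. by elim: w => [|x w IHw] /=; rewrite ?on_one // IHw on_tens_ob. Qed.

Record mor_bar (C : smcat) := MorBar {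
  bar_mor : mor C;
  bar_src : seq (ob C);
  bar_tgt : seq (ob C);
  bar_srcE : src bar_mor = eps bar_src;
  bar_tgtE : tgt bar_mor = eps bar_tgt }.

Lemma mor_bar_eq C (u v : mor_bar C) :
  bar_mor u = bar_mor v -> bar_src u = bar_src v -> bar_tgt u = bar_tgt v ->
  u = v.
Proof.
case: u v => [e x y p q] [e' x' y' p' q'] /= ee ex ey; subst e' x' y'.
by congr MorBar; apply: Prop_irrelevance.
Qed.

Definition U_ob (C : smcat) : prenet :=
  @Prenet (mor_bar C) (ob C) (@bar_src C) (@bar_tgt C).

Definition U_trans C D (F : smfunctor C D) (u : mor_bar C) : mor_bar D.
Proof.
exists (on_mor F (bar_mor u))
       (map (on_ob F) (bar_src u)) (map (on_ob F) (bar_tgt u)).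
- by rewrite on_src bar_srcE eps_map.
- by rewrite on_tgt bar_tgtE eps_map.
Defined.

Definition U_map C D (F : smfunctor C D) : prenet_hom (U_ob C) (U_ob D) :=
  @PrenetHom (U_ob C) (U_ob D) (U_trans F) (on_ob F)
    (fun=> erefl) (fun=> erefl).

Definition U_MON : functor MC PreNet.
Proof.
apply: (@Functor MC PreNet U_ob U_map).
- move=> C; apply: prenet_hom_eq => //= u.
  by apply: mor_bar_eq => //=; rewrite map_id.
- move=> C D E G F; apply: prenet_hom_eq => //= u.
  by apply: mor_bar_eq => //=; rewrite map_comp.
Defined.

Section Free.
Variable P : prenet.

Inductive term : seq (place P) -> seq (place P) -> Type :=
| Gen (t : trans P) : term (pre t) (post t)
| Id x : term x x
| Comp x y z : term y z -> term x y -> term x z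
| Tens x y x' y' : term x y -> term x' y' -> term (x ++ x') (y ++ y').

(* The congruence generated by the axioms of strict monoidal categories. It
   relates terms whose types may only be propositionally equal, as the two
   sides of the associativity of the tensor product; related terms still have
   equal ends (lemma [teq_ends] below). *)
Inductive teq : forall x y x' y', term x y -> term x' y' -> Prop :=
| teq_refl x y (f : term x y) : teq f f
| teq_sym x y x' y' (f : term x y) (f' : term x' y') : teq f f' -> teq f' f
| teq_trans x y x' y' x'' y''
    (f : term x y) (f' : term x' y') (f'' : term x'' y'') :
    teq f f' -> teq f' f'' -> teq f f''
| teq_Comp x y z x' y' z' (g : term y z) (f : term x y)
    (g' : term y' z') (f' : term x' y') :
    teq g g' -> teq f f' -> teq (Comp g f) (Comp g' f')
| teq_Tens x1 y1 x2 y2 x1' y1' x2' y2' (f : term x1 y1) (g : term x2 y2)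
    (f' : term x1' y1') (g' : term x2' y2') :
    teq f f' -> teq g g' -> teq (Tens f g) (Tens f' g')
| teq_CompA x y z w (h : term z w) (g : term y z) (f : term x y) :
    teq (Comp h (Comp g f)) (Comp (Comp h g) f)
| teq_Comp1m x y (f : term x y) : teq (Comp (Id y) f) f
| teq_Compm1 x y (f : term x y) : teq (Comp f (Id x)) f
| teq_TensA x1 y1 x2 y2 x3 y3
    (f : term x1 y1) (g : term x2 y2) (h : term x3 y3) :
    teq (Tens (Tens f g) h) (Tens f (Tens g h))
| teq_Tens1m x y (f : term x y) : teq (Tens (Id [::]) f) f
| teq_Tensm1 x y (f : term x y) : teq (Tens f (Id [::])) f
| teq_Tens_Id x y : teq (Tens (Id x) (Id y)) (Id (x ++ y))
| teq_Tens_Comp x1 y1 z1 x2 y2 z2 (f1 : term y1 z1) (g1 : term x1 y1)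
    (f2 : term y2 z2) (g2 : term x2 y2) :
    teq (Tens (Comp f1 g1) (Comp f2 g2)) (Comp (Tens f1 f2) (Tens g1 g2)).

Record arrow := Arrow {
  asrc : seq (place P);
  atgt : seq (place P);
  aterm : term asrc atgt }.

HB.instance Definition _ := gen_eqMixin arrow.
HB.instance Definition _ := gen_choiceMixin arrow.

Definition aeq (f g : arrow) : bool := `[< teq (aterm f) (aterm g) >].

Lemma aeq_refl : reflexive aeq.
Proof. by move=> f; apply/asboolP; apply: teq_refl. Qed.

Lemma aeq_sym : symmetric aeq.
Proof. by move=> f g; apply/asboolP/asboolP; apply: teq_sym. Qed.

Lemma aeq_trans : transitive aeq.
Proof.
by move=> g f h /asboolP fg /asboolP gh; apply/asboolP; apply: teq_trans gh.
Qed.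

Canonical aeq_equiv := EquivRel aeq aeq_refl aeq_sym aeq_trans.

Definition fmor := {eq_quot aeq}.

Lemma teq_ends x y x' y' (f : term x y) (f' : term x' y') :
  teq f f' -> x = x' /\ y = y'.
Proof.
elim=> {x y x' y' f f'} //=.
- by move=> *; intuition congruence.
- by move=> *; intuition congruence.
- by move=> *; intuition congruence.
- by move=> x1 y1 x2 y2 x1' y1' x2' y2' f g f' g' _ [-> ->] _ [-> ->].
- by move=> *; rewrite !catA.
- by move=> *; rewrite !cats0.
Qed.

Definition cast_src y y' z (p : y = y') (g : term y z) : term y' z :=
  ecast y (term y z) p g.

Definition acomp (g f : arrow) (p : asrc g = atgt f) : arrow :=
  Arrow (Comp (cast_src p (aterm g)) (aterm f)).

Definition atens (f g : arrow) : arrow := Arrow (Tens (aterm f) (aterm g)).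

Definition fsrc (f : fmor) : seq (place P) := asrc (repr f).
Definition ftgt (f : fmor) : seq (place P) := atgt (repr f).
Definition fgen (t : trans P) : fmor := \pi_fmor (Arrow (Gen t)).
Definition fid (x : seq (place P)) : fmor := \pi_fmor (Arrow (Id x)).
Definition fcomp (g f : fmor) (p : fsrc g = ftgt f) : fmor :=
  \pi_fmor (@acomp (repr g) (repr f) p).
Definition ftens (f g : fmor) : fmor := \pi_fmor (atens (repr f) (repr g)).

Lemma fmorP (f g : arrow) :
  teq (aterm f) (aterm g) <-> \pi_fmor f = \pi_fmor g.
Proof.
split=> [fg|fg]; first by apply/eqmodP/asboolP.
by apply/asboolP; apply/(@eqmodP _ aeq_equiv).
Qed.

Lemma teq_repr (f : arrow) : teq (aterm (repr (\pi_fmor f))) (aterm f).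
Proof. by apply/fmorP; rewrite reprK. Qed.

Lemma fsrc_pi (f : arrow) : fsrc (\pi_fmor f) = asrc f.
Proof. by case: (teq_ends (teq_repr f)). Qed.

Lemma ftgt_pi (f : arrow) : ftgt (\pi_fmor f) = atgt f.
Proof. by case: (teq_ends (teq_repr f)). Qed.

Lemma teq_acomp (g f g' f' : arrow) (p : asrc g = atgt f)
    (p' : asrc g' = atgt f') :
  teq (aterm g) (aterm g') -> teq (aterm f) (aterm f') ->
  teq (aterm (acomp p)) (aterm (acomp p')).
Proof.
case: g f g' f' p p' => [y z g] [x y0 f] [y' z' g'] [x' y0' f'] /= p p'.
by subst y0 y0'; apply: teq_Comp.
Qed.

Lemma fcomp_pi (g f : arrow) (p : asrc g = atgt f)
    (p' : fsrc (\pi_fmor g) = ftgt (\pi_fmor f)) :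
  fcomp p' = \pi_fmor (acomp p).
Proof. by apply/fmorP; apply: teq_acomp; apply: teq_repr. Qed.

Lemma ftens_pi (f g : arrow) :
  ftens (\pi_fmor f) (\pi_fmor g) = \pi_fmor (atens f g).
Proof. by apply/fmorP; apply: teq_Tens; apply: teq_repr. Qed.

Definition free_smcat : smcat.
Proof.
apply: (@SMCat (seq (place P)) fmor fsrc ftgt fid fcomp _ _ _ _ _ _ _
  [::] cat ftens).
- by move=> x; rewrite fsrc_pi.
- by move=> x; rewrite ftgt_pi.
- by move=> g f p; rewrite fsrc_pi.
- by move=> g f p; rewrite ftgt_pi.
- move=> x; elim/quotW=> -[y z f] p.
  have q : x = z by move: p; rewrite /fid fsrc_pi ftgt_pi.
  by subst z; rewrite (fcomp_pi (erefl : asrc (Arrow (Id x)) = atgt (Arrow f)));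
    apply/fmorP; apply: teq_Comp1m.
- move=> x; elim/quotW=> -[y z f] p.
  have q : y = x by move: p; rewrite /fid fsrc_pi ftgt_pi.
  by subst y; rewrite (fcomp_pi (erefl : asrc (Arrow f) = atgt (Arrow (Id x))));
    apply/fmorP; apply: teq_Compm1.
- elim/quotW=> -[z w h]; elim/quotW=> -[y z' g]; elim/quotW=> -[x y' f] p q.
  have ep : y = y' by move: p; rewrite fsrc_pi ftgt_pi.
  have eq : z = z' by move: q; rewrite fsrc_pi ftgt_pi.
  subst y' z'.
  rewrite (fcomp_pi (erefl : asrc (Arrow g) = atgt (Arrow f))).
  rewrite (fcomp_pi (erefl : asrc (Arrow h) = atgt (Arrow g))) => p' q'.
  rewrite (fcomp_pi (erefl : asrc (Arrow h) = atgt (Arrow (Comp g f)))).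
  rewrite (fcomp_pi (erefl : asrc (Arrow (Comp h g)) = atgt (Arrow f))).
  by apply/fmorP; apply: teq_CompA.
- exact: catA.
- exact: cat0s.
- exact: cats0.
- elim/quotW=> f; elim/quotW=> g; elim/quotW=> h.
  rewrite (ftens_pi g h) (ftens_pi f g).
  rewrite (ftens_pi f (atens g h)) (ftens_pi (atens f g) h).
  by apply/fmorP; exact: teq_sym (teq_TensA (aterm f) (aterm g) (aterm h)).
- by elim/quotW=> f; rewrite ftens_pi; apply/fmorP; apply: teq_Tens1m.
- by elim/quotW=> f; rewrite ftens_pi; apply/fmorP; apply: teq_Tensm1.
- by move=> f g; rewrite fsrc_pi.
- by move=> f g; rewrite ftgt_pi.
- by move=> x y; rewrite ftens_pi; apply/fmorP; apply: teq_Tens_Id.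
- elim/quotW=> -[y1 z1 f1]; elim/quotW=> -[x1 y1' g1].
  elim/quotW=> -[y2 z2 f2]; elim/quotW=> -[x2 y2' g2] p1 p2.
  have e1 : y1 = y1' by move: p1; rewrite fsrc_pi ftgt_pi.
  have e2 : y2 = y2' by move: p2; rewrite fsrc_pi ftgt_pi.
  subst y1' y2'.
  rewrite (fcomp_pi (erefl : asrc (Arrow f1) = atgt (Arrow g1))).
  rewrite (fcomp_pi (erefl : asrc (Arrow f2) = atgt (Arrow g2))).
  rewrite !ftens_pi => p.
  rewrite (fcomp_pi (erefl : asrc (Arrow (Tens f1 f2))
                           = atgt (Arrow (Tens g1 g2)))).
  by apply/fmorP; apply: teq_Tens_Comp.
Defined.

End Free.

(* [m] is a composition-preserving monoid homomorphism between the morphisms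
   of the free strict monoidal categories, lying over the homomorphism of free
   monoids [map (on_place h)] and extending [on_trans h]. Preservation of all
   identities is not required: only that of the unit of the monoid is. *)
Record extends_prenet_hom (P Q : prenet) (h : prenet_hom P Q)
    (m : mor (free_smcat P) -> mor (free_smcat Q)) : Prop := ExtendsPrenetHom {
  ext_src : forall f, src (m f) = map (on_place h) (src f);
  ext_tgt : forall f, tgt (m f) = map (on_place h) (tgt f);
  ext_comp : forall g f (p : src g = tgt f) (p' : src (m g) = tgt (m f)),
    m (comp g f p) = comp (m g) (m f) p';
  ext_one : m (idm one) = idm one;
  ext_tens : forall f g, m (tens f g) = tens (m f) (m g);
  ext_gen : forall t, m (fgen t) = fgen (on_trans h t) }.

(* Main.v *)
From mathcomp Require Import boolp.
Require Import Defs.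
From mathcomp Require Import all_boot.

(** The category [free_smcat P] is a term model, so a strict monoidal functor
    out of it amounts to its values on the places and transitions of [P].

    Existence.  A pre-net morphism from [P] to [U_MON D] says where places and
    transitions go; structural recursion on terms gives a morphism of [D] for
    each term ([eval]).  Every rule generating [teq] is an instance of an axiom
    of strict monoidal categories, so [eval] descends to the quotient
    ([eval_teq]) and yields the functor [extend].

    Uniqueness.  Every object is a tensor product of one-letter words, and
    every morphism is built from generators and identities by composition and
    tensor, so two functors that agree on letters and generators are equal
    ([free_functor_eq]).

    These two facts say that [restrict], the precomposition with the inclusion
    of [P] in the pre-net underlying its free category, is inverse to [extend].
    This is the adjunction, and naturality is immediate on the side of
    [restrict].

    The last claim is that the morphism part of the functor induced by [h] is
    the only composition-preserving monoid homomorphism extending [h].  Here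
    preservation of identities has to be derived.  The number of generators in
    a term is invariant under the axioms and additive under composition, so an
    idempotent contains no generator at all, and a term without generators is
    an identity ([idempotent_fid]).  A map that preserves composition sends
    identities to idempotents, hence to identities; it is therefore a functor
    ([extension_functor]), and uniqueness of functors applies. *)

Set Implicit Arguments.
Unset Strict Implicit.
Unset Printing Implicit Defensive.

Local Open Scope quotient_scope.

(** * Composition as a total operation *)

(** Totalising composition frees the recursion on terms from carrying
    composability proofs; the value on non-composable pairs is junk. *)
Definition compose (D : smcat) (g f : mor D) : mor D :=
  if pselect (src g = tgt f) is left p then Defs.comp g f p else g.

Section Compose.
Variable D : smcat.
Implicit Types f g h : mor D.

Lemma composeE g f (p : src g = tgt f) : compose g f = Defs.comp g f p.
Proof.
rewrite /compose; case: pselect => // q.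
by congr Defs.comp; apply: Prop_irrelevance.
Qed.

Lemma src_compose g f : src g = tgt f -> src (compose g f) = src f.
Proof. by move=> p; rewrite (composeE p) src_comp. Qed.

Lemma tgt_compose g f : src g = tgt f -> tgt (compose g f) = tgt g.
Proof. by move=> p; rewrite (composeE p) tgt_comp. Qed.

Lemma compose1m x f : tgt f = x -> compose (idm x) f = f.
Proof.
move=> fx; have p : src (idm x) = tgt f by rewrite src_id.
by rewrite (composeE p) comp1m.
Qed.

Lemma composem1 x f : src f = x -> compose f (idm x) = f.
Proof.
move=> fx; have p : src f = tgt (idm x) by rewrite tgt_id.
by rewrite (composeE p) compm1.
Qed.

Lemma composeA h g f : src g = tgt f -> src h = tgt g ->
  compose h (compose g f) = compose (compose h g) f.
Proof.
move=> p q; rewrite (composeE p) (composeE q).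
have p' : src h = tgt (Defs.comp g f p) by rewrite tgt_comp.
have q' : src (Defs.comp h g q) = tgt f by rewrite src_comp.
by rewrite (composeE p') (composeE q'); apply: compmA.
Qed.

Lemma tens_compose f1 g1 f2 g2 : src f1 = tgt g1 -> src f2 = tgt g2 ->
  tens (compose f1 g1) (compose f2 g2) = compose (tens f1 f2) (tens g1 g2).
Proof.
move=> p1 p2; have p : src (tens f1 f2) = tgt (tens g1 g2).
  by rewrite src_tens tgt_tens p1 p2.
by rewrite (composeE p1) (composeE p2) (composeE p); apply: tens_comp.
Qed.

Lemma eps_cat (v w : seq (ob D)) : eps (v ++ w) = tens_ob (eps v) (eps w).
Proof. by elim: v => [|x v IHv] /=; rewrite ?tens_ob1x // IHv tens_obA. Qed.

Lemma eps_seq1 (x : ob D) : eps [:: x] = x.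
Proof. exact: tens_obx1. Qed.

End Compose.

Lemma on_compose (C D : smcat) (F : smfunctor C D) (g f : mor C) :
  src g = tgt f -> on_mor F (compose g f) = compose (on_mor F g) (on_mor F f).
Proof.
move=> p; have p' : src (on_mor F g) = tgt (on_mor F f).
  by rewrite on_src on_tgt p.
by rewrite (composeE p) (composeE p'); apply: on_comp.
Qed.

Lemma pi_composable (P : prenet) x y z (g : @term P y z) (f : term x y) :
  @src (free_smcat P) (\pi_(fmor P) (Arrow g)) =
  @tgt (free_smcat P) (\pi_(fmor P) (Arrow f)).
Proof. by rewrite /= fsrc_pi ftgt_pi. Qed.

Lemma pi_Comp (P : prenet) x y z (g : @term P y z) (f : term x y) :
  \pi_(fmor P) (Arrow (Comp g f)) =
  @compose (free_smcat P) (\pi_(fmor P) (Arrow g)) (\pi_(fmor P) (Arrow f)).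
Proof.
rewrite (composeE (pi_composable g f)) /=.
by rewrite (fcomp_pi (erefl : asrc (Arrow g) = atgt (Arrow f))).
Qed.

Lemma pi_Tens (P : prenet) x y x' y' (f : term x y) (g : term x' y') :
  \pi_(fmor P) (Arrow (Tens f g)) =
  ftens (\pi_(fmor P) (Arrow f)) (\pi_(fmor P) (Arrow g)).
Proof. by rewrite ftens_pi. Qed.

(** * Existence: extending a pre-net morphism to a strict monoidal functor *)

Section Extend.
Variables (P : prenet) (D : smcat) (h : prenet_hom P (U_ob D)).

Definition eval_ob (w : seq (place P)) : ob D := eps (map (on_place h) w).

Fixpoint eval x y (f : term x y) : mor D :=
  match f with
  | Gen t => bar_mor (on_trans h t)
  | Id x => idm (eval_ob x)
  | Comp _ _ _ g f => compose (eval g) (eval f)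
  | Tens _ _ _ _ f g => tens (eval f) (eval g)
  end.

Lemma eval_ob_cat v w : eval_ob (v ++ w) = tens_ob (eval_ob v) (eval_ob w).
Proof. by rewrite /eval_ob map_cat eps_cat. Qed.

Lemma eval_ends x y (f : term x y) :
  src (eval f) = eval_ob x /\ tgt (eval f) = eval_ob y.
Proof.
elim: f => {x y} [t|x|x y z g [sg tg] f [sf tf]|x y x' y' f [sf tf] g [sg tg]].
- by rewrite /= bar_srcE bar_tgtE /eval_ob -on_pre -on_post.
- by rewrite /= src_id tgt_id.
- by rewrite /= src_compose ?tgt_compose ?sg ?tf.
- by rewrite /= src_tens tgt_tens sf tf sg tg !eval_ob_cat.
Qed.

Lemma src_eval x y (f : term x y) : src (eval f) = eval_ob x.
Proof. by case: (eval_ends f). Qed.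

Lemma tgt_eval x y (f : term x y) : tgt (eval f) = eval_ob y.
Proof. by case: (eval_ends f). Qed.

Lemma eval_composable x y z (g : term y z) (f : term x y) :
  src (eval g) = tgt (eval f).
Proof. by rewrite src_eval tgt_eval. Qed.

(** Each generating rule of [teq] becomes an axiom of [D]; the total composition
    satisfies these axioms only on composable pairs, and the values of
    composable terms are composable. *)
Lemma eval_teq x y x' y' (f : term x y) (f' : term x' y') :
  teq f f' -> eval f = eval f'.
Proof.
elim=> {x y x' y' f f'} //=.
- by move=> x y x' y' x'' y'' f f' f'' _ -> _ ->.
- by move=> x y z x' y' z' g f g' f' _ -> _ ->.
- by move=> x1 y1 x2 y2 x1' y1' x2' y2' f g f' g' _ -> _ ->.
- by move=> x y z w k g f; apply: composeA; apply: eval_composable.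
- by move=> x y f; apply: compose1m; apply: tgt_eval.
- by move=> x y f; apply: composem1; apply: src_eval.
- by move=> *; rewrite tensA.
- by move=> *; rewrite tens1m.
- by move=> *; rewrite tensm1.
- by move=> x y; rewrite tens_id eval_ob_cat.
- by move=> *; apply: tens_compose; apply: eval_composable.
Qed.

Definition eval_fmor (f : fmor P) : mor D := eval (aterm (repr f)).

Lemma eval_fmor_pi x y (f : term x y) :
  eval_fmor (\pi_(fmor P) (Arrow f)) = eval f.
Proof. exact: eval_teq (teq_repr (Arrow f)). Qed.

Definition extend : smfunctor (free_smcat P) D.
Proof.
exists eval_ob eval_fmor.
- by move=> f; apply: src_eval.
- by move=> f; apply: tgt_eval.
- by move=> x; apply: eval_fmor_pi.
- elim/quotW=> -[y z g]; elim/quotW=> -[x y' f] p p'.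
  have e : y = y' by move: p; rewrite /= fsrc_pi ftgt_pi.
  by subst y'; rewrite -(composeE p') -(composeE p) -pi_Comp !eval_fmor_pi.
- by [].
- exact: eval_ob_cat.
- elim/quotW=> -[x y f]; elim/quotW=> -[x' y' g].
  by rewrite /= -pi_Tens !eval_fmor_pi.
Defined.

Lemma extend_fgen t : on_mor extend (fgen t) = bar_mor (on_trans h t).
Proof. exact: eval_fmor_pi. Qed.

Lemma extend_seq1 s : on_ob extend [:: s] = on_place h s.
Proof. exact: eps_seq1. Qed.

End Extend.

(** * Uniqueness: functors out of the free category *)

Section FreeFunctor.
Variables (P : prenet) (D : smcat).

Lemma free_functor_ob (F : smfunctor (free_smcat P) D) (w : seq (place P)) :
  on_ob F w = eps [seq on_ob F [:: s] | s <- w].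
Proof.
elim: w => [|s w IHw] /=; first exact: (on_one F).
by rewrite -IHw; apply: (on_tens_ob F [:: s] w).
Qed.

(** Agreement on one-letter words propagates to all words because functors are
    monoidal, and then agreement on generators propagates along terms. *)
Lemma free_functor_eq (F G : smfunctor (free_smcat P) D) :
  (forall s, on_ob F [:: s] = on_ob G [:: s]) ->
  (forall t, on_mor F (fgen t) = on_mor G (fgen t)) -> F = G.
Proof.
move=> eq_ob eq_gen.
have eqFG w : on_ob F w = on_ob G w.
  by rewrite !free_functor_ob; congr eps; apply: eq_map.
apply: smfunctor_eq; first exact: eqFG.
elim/quotW=> -[x y f]; elim: f => {x y} [t|x|x y z g IHg f IHf|].
- exact: eq_gen.
- by rewrite (on_id F) (on_id G) eqFG.
- by rewrite pi_Comp !(on_compose _ (pi_composable g f)) IHg IHf.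
- move=> x y x' y' f IHf g IHg.
  by rewrite pi_Tens (on_tens F) (on_tens G) IHf IHg.
Qed.

End FreeFunctor.

(** * The adjunction *)

Section Restrict.
Variables (P : prenet) (D : smcat) (F : smfunctor (free_smcat P) D).

Lemma src_on_fgen t :
  src (on_mor F (fgen t)) = eps [seq on_ob F [:: s] | s <- pre t].
Proof. by rewrite on_src /= fsrc_pi free_functor_ob. Qed.

Lemma tgt_on_fgen t :
  tgt (on_mor F (fgen t)) = eps [seq on_ob F [:: s] | s <- post t].
Proof. by rewrite on_tgt /= ftgt_pi free_functor_ob. Qed.

(** A transition of [U_MON D] carries words of objects, not just a source and a
    target; the words attached to the image of a generator are forced by
    compatibility with the map on places. *)
Definition restrict : prenet_hom P (U_ob D) :=
  @PrenetHom P (U_ob D) (fun t => MorBar (src_on_fgen t) (tgt_on_fgen t))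
    (fun s => on_ob F [:: s]) (fun=> erefl) (fun=> erefl).

End Restrict.

Lemma restrictK (P : prenet) (D : smcat) :
  cancel (@restrict P D) (@extend P D).
Proof.
move=> F; apply: free_functor_eq => [s|t]; first by rewrite extend_seq1.
by rewrite extend_fgen.
Qed.

(** The word components agree because a pre-net morphism already determines
    them from its values on places. *)
Lemma extendK (P : prenet) (D : smcat) : cancel (@extend P D) (@restrict P D).
Proof.
move=> h; apply: prenet_hom_eq => [t|s]; last exact: extend_seq1.
apply: mor_bar_eq; first exact: extend_fgen.
- by rewrite [RHS](on_pre h); apply: eq_map => s; apply: extend_seq1.
- by rewrite [RHS](on_post h); apply: eq_map => s; apply: extend_seq1.
Qed.

(** In the free category the tensor product of the letters of a word is the word
    itself; this makes the object part of [free_map] equal to [map]. *)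
Lemma eps_free (Q : prenet) (w : seq (place Q)) :
  eps (C := free_smcat Q) [seq [:: s] | s <- w] = w.
Proof. by elim: w => //= s w ->. Qed.

(** The unit of the adjunction. *)
Definition free_unit (Q : prenet) : prenet_hom Q (U_ob (free_smcat Q)) :=
  restrict (smfunctor_id (free_smcat Q)).

Definition free_map (P Q : prenet) (h : prenet_hom P Q) :
    smfunctor (free_smcat P) (free_smcat Q) :=
  extend (prenet_comp (free_unit Q) h).

Section FreeMap.
Variables (P Q : prenet) (h : prenet_hom P Q).

Lemma free_map_ob w : on_ob (free_map h) w = map (on_place h) w.
Proof.
by rewrite -[RHS]eps_free -map_comp.
Qed.

Lemma free_map_fgen t : on_mor (free_map h) (fgen t) = fgen (on_trans h t).
Proof. exact: extend_fgen. Qed.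

End FreeMap.

Lemma free_map_id (P : prenet) :
  free_map (prenet_id P) = smfunctor_id (free_smcat P).
Proof.
by apply: free_functor_eq => [s|t]; [rewrite free_map_ob|rewrite free_map_fgen].
Qed.

Lemma free_map_comp (P Q R : prenet) (v : prenet_hom Q R) (u : prenet_hom P Q) :
  free_map (prenet_comp v u) = smfunctor_comp (free_map v) (free_map u).
Proof.
apply: free_functor_eq => [s|t].
  by rewrite -[RHS]/(on_ob (free_map v) (on_ob (free_map u) _)) !free_map_ob.
by rewrite -[RHS]/(on_mor (free_map v) (on_mor (free_map u) _)) !free_map_fgen.
Qed.

Definition F_MON : functor PreNet MC :=
  @Functor PreNet MC free_smcat free_map free_map_id free_map_comp.

(** Naturality of the adjunction.  A pre-net morphism into [U_MON D'] is
    determined by its values on places and transitions, where both sides apply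
    [k] and then [v] to the letter or generator given by [u]. *)
Lemma restrict_natural (P P' : prenet) (D D' : smcat) (u : prenet_hom P' P)
    (v : smfunctor D D') (k : smfunctor (free_smcat P) D) :
  restrict (smfunctor_comp v (smfunctor_comp k (free_map u))) =
  prenet_comp (U_map v) (prenet_comp (restrict k) u).
Proof.
have on_places s :
    on_ob v (on_ob k (on_ob (free_map u) [:: s])) =
    on_ob v (on_ob k [:: on_place u s]) by rewrite free_map_ob.
apply: prenet_hom_eq => [t|s]; last exact: on_places.
apply: mor_bar_eq => /=.
- by congr (on_mor v (on_mor k _)); apply: free_map_fgen.
- by rewrite on_pre -!map_comp; apply: eq_map => s; apply: on_places.
- by rewrite on_post -!map_comp; apply: eq_map => s; apply: on_places.
Qed.

Definition free_adjunction : adjunction F_MON U_MON :=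
  @Adjunction PreNet MC F_MON U_MON restrict extend
    restrictK extendK restrict_natural.

(** * Idempotents of the free category are identities *)

Section Idempotent.
Variable P : prenet.

Fixpoint ngens x y (f : @term P x y) : nat :=
  match f with
  | Gen _ => 1
  | Id _ => 0
  | Comp _ _ _ g f => ngens g + ngens f
  | Tens _ _ _ _ f g => ngens f + ngens g
  end.

Lemma ngens_teq x y x' y' (f : @term P x y) (f' : @term P x' y') :
  teq f f' -> ngens f = ngens f'.
Proof.
elim=> {x y x' y' f f'} //=.
- by move=> x y x' y' x'' y'' f f' f'' _ -> _ ->.
- by move=> x y z x' y' z' g f g' f' _ -> _ ->.
- by move=> x1 y1 x2 y2 x1' y1' x2' y2' f g f' g' _ -> _ ->.
- by move=> *; rewrite addnA.
- by move=> *; rewrite addn0.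
- by move=> *; rewrite addnA.
- by move=> *; rewrite addn0.
- by move=> *; rewrite addnACA.
Qed.

(** Composites and tensors of identities are identities by the unit laws and by
    functoriality of the tensor. *)
Lemma ngens0_teq_Id x y (f : @term P x y) : ngens f = 0 -> teq f (Id x).
Proof.
elim: f => {x y} //= [x _|x y z g IHg f IHf|x y x' y' f IHf g IHg].
- exact: teq_refl.
- move=> /eqP; rewrite addn_eq0 => /andP[/eqP/IHg eg /eqP/IHf ef].
  have [_ exy] := teq_ends ef; subst y.
  exact: teq_trans (teq_Comp eg ef) (teq_Comp1m _).
- move=> /eqP; rewrite addn_eq0 => /andP[/eqP/IHf ef /eqP/IHg eg].
  exact: teq_trans (teq_Tens ef eg) (teq_Tens_Id x x').
Qed.

(** Composing doubles the number of generators, so an idempotent has none. *)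
Lemma idempotent_fid (f : fmor P) (p : fsrc f = ftgt f) :
  fcomp p = f -> f = fid (fsrc f).
Proof.
elim/quotW: f p => -[x y f] p.
have e : x = y by move: p; rewrite fsrc_pi ftgt_pi.
subst y; rewrite -[fcomp p](@composeE (free_smcat P)) -pi_Comp => /fmorP /ngens_teq /= nff.
rewrite fsrc_pi /=; apply/fmorP/ngens0_teq_Id.
by apply/eqP; rewrite -(eqn_add2l (ngens f)) nff addn0.
Qed.

End Idempotent.

(** * Uniqueness of the extension on morphisms *)

Section Extension.
Variables (P Q : prenet) (h : prenet_hom P Q).

(** An identity is idempotent, and so is its image under [m]. *)
Lemma extension_fid (m : fmor P -> fmor Q) (mh : extends_prenet_hom h m) x :
  m (fid x) = fid (map (on_place h) x).
Proof.
have sx : fsrc (m (fid x)) = map (on_place h) x.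
  by rewrite [LHS](ext_src mh) /= fsrc_pi.
have p : fsrc (fid x) = ftgt (fid x) by rewrite fsrc_pi ftgt_pi.
have p' : fsrc (m (fid x)) = ftgt (m (fid x)).
  by rewrite sx [RHS](ext_tgt mh) /= ftgt_pi.
rewrite -sx; apply: (@idempotent_fid _ _ p').
have /= <- := ext_comp mh p p'.
by congr m; apply: (@comp1m (free_smcat P) x (fid x) p).
Qed.

Definition extension_functor (m : fmor P -> fmor Q)
  (mh : extends_prenet_hom h m) : smfunctor (free_smcat P) (free_smcat Q).
Proof.
exists (map (on_place h)) m.
- exact: ext_src mh.
- exact: ext_tgt mh.
- exact: extension_fid mh.
- exact: ext_comp mh.
- by [].
- by move=> x y /=; rewrite map_cat.
- exact: ext_tens mh.
Defined.

Lemma free_map_extends : extends_prenet_hom h (on_mor (free_map h)).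
Proof.
split.
- by move=> f; rewrite on_src free_map_ob.
- by move=> f; rewrite on_tgt free_map_ob.
- exact: on_comp.
- by rewrite on_id on_one.
- exact: on_tens.
- exact: free_map_fgen.
Qed.

Lemma extension_unique (m : fmor P -> fmor Q) :
  extends_prenet_hom h m -> on_mor (free_map h) = m.
Proof.
move=> mh; suff -> : free_map h = extension_functor mh by [].
apply: free_functor_eq => [s|t]; first by rewrite free_map_ob.
by rewrite free_map_fgen /= (ext_gen mh).
Qed.

End Extension.

Theorem proposition6p1 :
  exists (F_map : forall P Q : PreNet,
            hom P Q -> @hom MC (free_smcat P) (free_smcat Q))
         (F_id : forall P : PreNet,
            F_map P P (cid P) = @cid MC (free_smcat P))
         (F_comp : forall (P Q R : PreNet) (v : hom Q R) (u : hom P Q),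
            F_map P R (ccomp v u) = @ccomp MC _ _ _ (F_map Q R v) (F_map P Q u)),
    let F_MON : functor PreNet MC := @Functor PreNet MC free_smcat F_map F_id F_comp in
    inhabited (adjunction F_MON U_MON) /\
    forall (P Q : PreNet) (h : prenet_hom P Q),
      on_ob (fmap F_MON h) = map (on_place h) /\
      unique (extends_prenet_hom h) (on_mor (fmap F_MON h)).
Proof.
exists free_map, free_map_id, free_map_comp; split.
  by split; apply: free_adjunction.
move=> P Q h; split; first by apply/funext => w; apply: free_map_ob.
by split; [apply: free_map_extends|apply: extension_unique].
Qed.
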